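(* Let $\Lambda_0, \Lambda_1,\dots, \Lambda_{n+1}$ be a Lagrangian path, and let $S=S(\Lambda_0,\dots,\Lambda_{n+1})$ denote its Sylvester matrix. Assume that there exist two indices $0 \leq i < j \leq n+1$ such that $\Lambda_i \pitchfork \Lambda_j$. Then the sub-sequence $\Lambda_i,\Lambda_{i+1}, \dots, \Lambda_j$ and the shortened sequence $\Lambda_0, \dots, \Lambda_i,\Lambda_j, \dots, \Lambda_{n+1}$ are Lagrangian paths, and $$S \text{ is isometric to } S(\Lambda_i,\dots,\Lambda_j)\ \bot\ S(\Lambda_0,\dots,\Lambda_i,\Lambda_j,\dots,\Lambda_{n+1}),$$ where $\bot$ denotes the orthogonal sum of symmetric bilinear forms.
   Context: $k$ is a field of characteristic different from $2$, $g\ge 1$, $L=k^g$, and $H(L)=L\oplus L^*$ carries the symplectic form $\omega((x,\xi),(y,\eta))=\xi(y)-\eta(x)$. A Lagrangian is a subspace $\Lambda\subset H(L)$ with $\Lambda=\Lambda^\perp$ (orthogonal for $\omega$). Two Lagrangians are transverse, $\Lambda\pitchfork M$, if $\Lambda+M=H(L)$. For Lagrangians $\Lambda,M$ let $\beta_{\Lambda,M}:\Lambda\to M^*$, $\ell\mapsto \omega(\ell,-)|_M$; it is invertible iff $\Lambda\pitchfork M$. If $X$ is a Lagrangian and $\Lambda,M$ are Lagrangians transverse to $X$, then $d_X(\Lambda,M):X^*\to X$ is the symmetric linear map sending $\alpha\in X^*$ to $m-\ell\in X$, where $m\in M$ and $\ell\in\Lambda$ are the unique elements with $\omega(m,-)|_X=\alpha=\omega(\ell,-)|_X$.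 A Lagrangian path (of length $n\ge 0$) is a sequence of Lagrangians $\Lambda_0,\dots,\Lambda_{n+1}$ with $\Lambda_i\pitchfork\Lambda_{i+1}$ for $0\le i\le n$. Its Sylvester matrix is the symmetric bilinear form with support $\Lambda_1^*\oplus\dots\oplus\Lambda_n^*$, viewed as a linear map $\Lambda_1^*\oplus\dots\oplus\Lambda_n^*\to\Lambda_1\oplus\dots\oplus\Lambda_n$, which is block tridiagonal with diagonal blocks $d_{\Lambda_i}(\Lambda_{i-1},\Lambda_{i+1})$ ($1\le i\le n$), blocks $(\beta_{\Lambda_i,\Lambda_{i+1}})^{-1}$ in position $(i,i+1)$ and $-(\beta_{\Lambda_{i+1},\Lambda_i})^{-1}$ in position $(i+1,i)$ ($1\le i\le n-1$), and zero elsewhere. For $n=0$ it is the form on the zero space. *)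

(* Defs.v *)
From HB Require Import structures.
From mathcomp Require Import all_boot all_order all_algebra.

Set Implicit Arguments.
Unset Strict Implicit.
Unset Printing Implicit Defensive.

Import GRing.Theory.
Local Open Scope ring_scope.

Notation vdual V := 'Hom(V, GRing.regular _).

Section DirectSum.

Variables (k : fieldType) (n : nat) (T : 'I_n -> vectType k).

Definition dsum : Type := {dffun forall i : 'I_n, T i}.
HB.instance Definition _ := Choice.on dsum.

Implicit Types x y z : dsum.

Definition dsum_zero : dsum := [ffun i => 0 : T i].
Definition dsum_opp x : dsum := [ffun i => - x i].
Definition dsum_add x y : dsum := [ffun i => x i + y i].
Definition dsum_scale (a : k) x : dsum := [ffun i => a *: x i].

Fact dsum_addA : associative dsum_add.
Proof. by move=> x y z; apply/ffunP => i; rewrite !ffunE addrA. Qed.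
Fact dsum_addC : commutative dsum_add.
Proof. by move=> x y; apply/ffunP => i; rewrite !ffunE addrC. Qed.
Fact dsum_add0 : left_id dsum_zero dsum_add.
Proof. by move=> x; apply/ffunP => i; rewrite !ffunE add0r. Qed.
Fact dsum_addN : left_inverse dsum_zero dsum_opp dsum_add.
Proof. by move=> x; apply/ffunP => i; rewrite !ffunE addNr. Qed.

HB.instance Definition _ :=
  GRing.isZmodule.Build dsum dsum_addA dsum_addC dsum_add0 dsum_addN.

Fact dsum_scaleA a b x : dsum_scale a (dsum_scale b x) = dsum_scale (a * b) x.
Proof. by apply/ffunP => i; rewrite !ffunE scalerA. Qed.
Fact dsum_scale1 : left_id 1 dsum_scale.
Proof. by move=> x; apply/ffunP => i; rewrite ffunE scale1r. Qed.
Fact dsum_scaleDr : right_distributive dsum_scale +%R.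
Proof. by move=> a x y; apply/ffunP => i; rewrite !ffunE scalerDr. Qed.
Fact dsum_scaleDl x : {morph dsum_scale^~ x : a b / a + b}.
Proof. by move=> a b; apply/ffunP => i; rewrite !ffunE scalerDl. Qed.

HB.instance Definition _ :=
  GRing.Zmodule_isLmodule.Build k dsum
    dsum_scaleA dsum_scale1 dsum_scaleDr dsum_scaleDl.

Lemma dsumDE x y i : (x + y) i = x i + y i. Proof. by rewrite ffunE. Qed.
Lemma dsumZE a x i : (a *: x) i = a *: x i. Proof. by rewrite ffunE. Qed.

End DirectSum.

(* A k-vector space together with a symmetric bilinear form on it. *)
Record sym_space (k : fieldType) := SymSpace {
  support : lmodType k;
  sform : {symmetric support} }.

Definition isometric (k : fieldType) (S S' : sym_space k) : Prop :=
  exists f : {linear support S -> support S'},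
    bijective f /\ isometry (sform S') (sform S) f.

Section OrthogonalSum.

Variables (k : fieldType) (S S' : sym_space k).

Definition orth_form (u v : support S * support S') : k :=
  sform S u.1 v.1 + sform S' u.2 v.2.

Fact orth_form_bilinear : bilinear_for *%R *%R orth_form.
Proof.
split=> u a v w; rewrite /orth_form /=.
- by rewrite !linearPl /= mulrDr addrACA.
- by rewrite !linearPr /= mulrDr addrACA.
Qed.
HB.instance Definition _ := bilinear_isBilinear.Build k _ _ _ _ _ orth_form
  orth_form_bilinear.

Fact orth_form_sym u v : orth_form u v = (-1) ^+ false * idfun (orth_form v u).
Proof.
by rewrite expr0 mul1r /= /orth_form hermC (hermC _ u.2) expr0 !mul1r.
Qed.
HB.instance Definition _ := isHermitianSesquilinear.Build k _ false idfun
  orth_form orth_form_sym.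

Definition orth_sum := SymSpace orth_form.

End OrthogonalSum.

Section Symplectic.

Variables (k : fieldType) (g : nat).

Definition hyperbolic : vectType k := ('rV[k]_g * vdual 'rV[k]_g)%type.

Definition omega (u v : hyperbolic) : k := u.2 v.1 - v.2 u.1.

Fact omega_bilinear : bilinear_for *%R *%R omega.
Proof.
split=> u a v w; rewrite /omega /= add_lfunE scale_lfunE linearP /=;
  by rewrite mulrBr opprD addrACA.
Qed.
HB.instance Definition _ := bilinear_isBilinear.Build k _ _ _ _ _ omega
  omega_bilinear.

Fact omega_skew u v : omega u v = (-1) ^+ true * idfun (omega v u).
Proof. by rewrite expr1 mulN1r /= opprB. Qed.
HB.instance Definition _ := isHermitianSesquilinear.Build k _ true idfun
  omega omega_skew.

Fact omega_scalar u : linear (omega u : hyperbolic -> k^o).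
Proof. by move=> a v w; rewrite linearPr. Qed.
HB.instance Definition _ u := GRing.isSemilinear.Build k hyperbolic k^o _
  (omega u) (GRing.semilinear_linear (omega_scalar u)).

Lemma omegaC u v : omega u v = - omega v u.
Proof. by rewrite opprB. Qed.

Lemma omega_nondeg u : (forall v, omega u v = 0) -> u = 0.
Proof.
case: u => x f u0; congr pair; last first.
  apply/lfunP => y; have := u0 (y, 0).
  by rewrite /omega /= !zero_lfunE subr0.
rewrite (coord_vbasis (memvf x)) big1 // => i _.
have := u0 (0, linfun (coord (vbasis fullv) i : _ -> k^o)).
by rewrite /omega /= linear0 lfunE sub0r => /eqP; rewrite oppr_eq0 => /eqP ->;
  rewrite scale0r.
Qed.

Implicit Types X L M : {vspace hyperbolic}.

Definition lagrangian L :=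
  L == orthov (omega : {skew_symmetric hyperbolic}) L.

Definition transverse L M := (L + M)%VS == fullv.

(* omega(u, -) restricted to M *)
Definition omega_on M (u : hyperbolic) : vdual (subvs_of M) :=
  linfun ((omega u : hyperbolic -> k^o) \o vsval).

Lemma omega_onE M u m : omega_on M u m = omega u (vsval m).
Proof. by rewrite lfunE. Qed.

Fact omega_on_linear M : linear (omega_on M).
Proof.
move=> a u v; apply/lfunP => m.
by rewrite add_lfunE scale_lfunE !omega_onE linearPl.
Qed.
HB.instance Definition _ M := GRing.isSemilinear.Build k _ _ _ (omega_on M)
  (GRing.semilinear_linear (omega_on_linear M)).

Definition beta L M : 'Hom(subvs_of L, vdual (subvs_of M)) :=
  linfun (omega_on M \o vsval).

Lemma betaE L M l m : beta L M l m = omega (vsval l) (vsval m).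
Proof. by rewrite lfunE /= omega_onE. Qed.

(* beta M X is only pseudo-inverted by ^-1%VF in general; when M and X are
   transverse Lagrangians it is an isomorphism (betaK, betaVK), the preimages
   under beta M X and beta L X of a are the elements m and l representing a on
   X, and m - l lies in X (vsval_dmap), so that vsproj X fixes it. *)
Definition dfun X L M (a : vdual (subvs_of X)) : subvs_of X :=
  vsproj X (vsval ((beta M X)^-1%VF a) - vsval ((beta L X)^-1%VF a)).

Arguments dfun : clear implicits.

Fact dfun_linear X L M : linear (dfun X L M).
Proof.
move=> c a b; rewrite /dfun -linearP; congr (vsproj X _).
by rewrite !linearP /= scalerDr addrACA.
Qed.
HB.instance Definition _ X L M := GRing.isSemilinear.Build k _ _ _ (dfun X L M)
  (GRing.semilinear_linear (@dfun_linear X L M)).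

Definition dmap X L M : 'Hom(vdual (subvs_of X), subvs_of X) :=
  linfun (dfun X L M).

Lemma lagrangianP L :
  reflect (forall u, u \in L <-> {in L, forall v, omega u v = 0})
          (lagrangian L).
Proof.
have oP u := @mem_orthovP k true idfun hyperbolic omega L u.
apply: (iffP eqP) => [LE u|LE]; last first.
  by apply/vspaceP => u; apply/idP/oP => /LE.
by rewrite {1}LE; apply: (iff_sym (rwP (oP u))).
Qed.

Lemma lagrangian_omega L u v :
  lagrangian L -> u \in L -> v \in L -> omega u v = 0.
Proof. by move=> /lagrangianP LE /LE; apply. Qed.

Lemma transverseC L M : transverse L M = transverse M L.
Proof. by rewrite /transverse addvC. Qed.

Lemma transverse_capv L M :
  lagrangian L -> lagrangian M -> transverse L M -> (L :&: M = 0)%VS.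
Proof.
move=> lL lM /eqP LM; apply/eqP; rewrite -subv0; apply/subvP => u.
rewrite memv_cap memv0 => /andP[uL uM]; apply/eqP/omega_nondeg => v.
have /memv_addP[l lL' [m mM ->]] : v \in (L + M)%VS by rewrite LM memvf.
rewrite linearDr /= (lagrangian_omega lL uL lL').
by rewrite (lagrangian_omega lM uM mM) addr0.
Qed.

Lemma beta_ker L M :
  lagrangian L -> lagrangian M -> transverse L M -> lker (beta L M) == 0%VS.
Proof.
move=> lL lM LM; rewrite -subv0; apply/subvP => l.
rewrite memv_ker memv0 => /eqP l0; apply/eqP/val_inj => /=.
apply/eqP; rewrite -memv0 -(transverse_capv lL lM LM) memv_cap subvsP /=.
apply/(lagrangianP _ lM) => m mM.
by rewrite -(vsprojK mM) -betaE l0 zero_lfunE.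
Qed.

Lemma dim_dual (V : vectType k) : \dim {: vdual V} = \dim {: V}.
Proof. by rewrite !dimvf /dim /= muln1. Qed.

Lemma dim_transverse L M :
  lagrangian L -> lagrangian M -> transverse L M -> \dim L = \dim M.
Proof.
move=> lL lM LM.
have le X Y (lX : lagrangian X) (lY : lagrangian Y) (XY : transverse X Y) :
    (\dim X <= \dim Y)%N.
  have dimE (Z : {vspace hyperbolic}) : \dim {: subvs_of Z} = \dim Z.
    by rewrite dimvf.
  have := limg_dim_eq (f := beta X Y) (U := fullv).
  rewrite (eqP (beta_ker lX lY XY)) capv0 => /(_ erefl).
  by rewrite dimE => <-; rewrite -(dimE Y) -dim_dual dimvS ?subvf.
by apply/eqP; rewrite eqn_leq !le // transverseC.
Qed.

Lemma betaK L M : lagrangian L -> lagrangian M -> transverse L M ->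
  cancel (beta L M) (beta L M)^-1%VF.
Proof. by move=> lL lM LM; apply/lker0_lfunK/beta_ker. Qed.

Lemma betaVK L M : lagrangian L -> lagrangian M -> transverse L M ->
  cancel (beta L M)^-1%VF (beta L M).
Proof.
move=> lL lM LM a; apply: limg_lfunVK; suff -> : limg (beta L M) = fullv.
  exact: memvf.
apply/eqP; rewrite eqEdim subvf dim_dual limg_dim_eq; last first.
  by rewrite (eqP (beta_ker lL lM LM)) capv0.
by rewrite !dimvf /dim /= (dim_transverse lL lM LM).
Qed.

Lemma omega_betaV L M (a : vdual (subvs_of M)) (m : subvs_of M) :
  lagrangian L -> lagrangian M -> transverse L M ->
  omega (vsval ((beta L M)^-1%VF a)) (vsval m) = a m.
Proof. by move=> lL lM LM; rewrite -betaE betaVK. Qed.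

Lemma vsval_dmap X L M a :
  lagrangian X -> lagrangian L -> lagrangian M ->
  transverse L X -> transverse M X ->
  vsval (dmap X L M a) =
    vsval ((beta M X)^-1%VF a) - vsval ((beta L X)^-1%VF a).
Proof.
move=> lX lL lM LX MX; rewrite lfunE /= vsprojK //.
apply/(lagrangianP _ lX) => x xX.
by rewrite linearBl /= -(vsprojK xX) !omega_betaV // subrr.
Qed.

Lemma dmap_sym X L M (a b : vdual (subvs_of X)) :
  lagrangian X -> lagrangian L -> lagrangian M ->
  transverse L X -> transverse M X -> a (dmap X L M b) = b (dmap X L M a).
Proof.
move=> lX lL lM LX MX.
rewrite -(omega_betaV a _ lM lX MX) -(omega_betaV b _ lL lX LX) !vsval_dmap //.
have M0 := lagrangian_omega lM (subvsP _) (subvsP ((beta M X)^-1%VF b)).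
have L0 := lagrangian_omega lL (subvsP _) (subvsP ((beta L X)^-1%VF a)).
by rewrite !linearBr /= M0 L0 sub0r subr0 -omegaC.
Qed.

Lemma betaV_sym L M (a : vdual (subvs_of L)) (b : vdual (subvs_of M)) :
  lagrangian L -> lagrangian M -> transverse L M ->
  a ((beta L M)^-1%VF b) = - b ((beta M L)^-1%VF a).
Proof.
move=> lL lM LM; have ML : transverse M L by rewrite transverseC.
by rewrite -(omega_betaV a _ lM lL ML) -(omega_betaV b _ lL lM LM) -omegaC.
Qed.

Definition lagrangian_path (s : seq {vspace hyperbolic}) : bool :=
  [&& (1 < size s)%N, all lagrangian s & sorted transverse s].

Section Sylvester.

Variable s : seq {vspace hyperbolic}.

Local Notation "''L_' i" := (nth 0%VS s i)
  (at level 8, i at level 2, format "''L_' i").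

(* The ordinal i : 'I_(size s - 2) stands for the inner index i.+1 of s. *)
Definition sylvester_dom :=
  dsum (fun i : 'I_(size s - 2) => vdual (subvs_of 'L_i.+1)).
Definition sylvester_cod := dsum (fun i : 'I_(size s - 2) => subvs_of 'L_i.+1).

(* The block in position (i, j) maps the j-th summand of sylvester_dom to the
   i-th summand of sylvester_cod. *)
Definition sylvester_diag (i : 'I_(size s - 2)) :
    'Hom(vdual (subvs_of 'L_i.+1), subvs_of 'L_i.+1) :=
  dmap 'L_i.+1 'L_i 'L_i.+2.

Definition sylvester_offdiag (i j : 'I_(size s - 2)) :
    'Hom(vdual (subvs_of 'L_j.+1), subvs_of 'L_i.+1) :=
  if j == i.+1 :> nat then (beta 'L_i.+1 'L_j.+1)^-1%VF
  else if i == j.+1 :> nat then - (beta 'L_i.+1 'L_j.+1)^-1%VF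
  else 0.

Definition sylvester_map (x : sylvester_dom) : sylvester_cod :=
  [ffun i => sylvester_diag i (x i)
             + \sum_(j | j != i) sylvester_offdiag i j (x j)].

Fact sylvester_map_linear : linear sylvester_map.
Proof.
move=> a x y; apply/ffunP => i; rewrite !ffunE linearP scalerDr addrACA.
congr (_ + _); rewrite scaler_sumr -big_split; apply: eq_bigr => j _ /=.
by rewrite !ffunE linearP.
Qed.
HB.instance Definition _ := GRing.isSemilinear.Build k _ _ _ sylvester_map
  (GRing.semilinear_linear sylvester_map_linear).

Definition sylvester_form (x y : sylvester_dom) : k :=
  \sum_i x i (sylvester_map y i).

Fact sylvester_form_bilinear : bilinear_for *%R *%R sylvester_form.
Proof.
split=> u a v w /=; rewrite /sylvester_form mulr_sumr -big_split;
  apply: eq_bigr => i _ /=.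
- by rewrite !dsumDE dsumZE add_lfunE scale_lfunE.
- by rewrite sylvester_map_linear dsumDE dsumZE [LHS]linearP.
Qed.
HB.instance Definition _ := bilinear_isBilinear.Build k _ _ _ _ _ sylvester_form
  sylvester_form_bilinear.

Lemma lagrangian_path_nth i : lagrangian_path s -> (i < size s)%N ->
  lagrangian 'L_i.
Proof. by move=> /and3P[_ /all_nthP lL _] /lL. Qed.

Lemma lagrangian_path_transverse i : lagrangian_path s -> (i.+1 < size s)%N ->
  transverse 'L_i 'L_i.+1.
Proof. by move=> /and3P[_ _ /sortedP] tL /tL. Qed.

Hypothesis sP : lagrangian_path s.

Fact sylvester_formC x y : sylvester_form x y = sylvester_form y x.
Proof.
rewrite /sylvester_form.
have ltS (i : 'I_(size s - 2)) : (i.+2 < size s)%N.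
  by have := ltn_ord i; rewrite ltn_subRL addnC addn2.
have lI (i : 'I_(size s - 2)) : lagrangian 'L_i.+1.
  by rewrite lagrangian_path_nth // ltnW.
under eq_bigr do rewrite ffunE linearD linear_sum.
under [RHS]eq_bigr do rewrite ffunE linearD linear_sum.
rewrite !big_split /=; congr (_ + _).
  apply: eq_bigr => i _; apply: dmap_sym => //.
  - by rewrite lagrangian_path_nth // ltnW // ltnW.
  - by rewrite lagrangian_path_nth.
  - by rewrite lagrangian_path_transverse // ltnW.
  - by rewrite transverseC lagrangian_path_transverse.
rewrite (exchange_big_dep xpredT) //=; apply: eq_bigr => j _.
rewrite (eq_bigl (fun i => i != j)); last by move=> i; rewrite eq_sym.
apply: eq_bigr => i _; rewrite /sylvester_offdiag.
have [ji|jNi] := eqVneq (j : nat) i.+1.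
  have -> : (i == j.+1 :> nat) = false.
    by rewrite ji; apply/negbTE; rewrite neq_ltn ltnS leqnSn.
  rewrite opp_lfunE linearN /= betaV_sym ?lI //.
  by rewrite ji lagrangian_path_transverse // -ji ltnW.
have [ij|iNj] := eqVneq (i : nat) j.+1; last by rewrite !zero_lfunE !linear0.
rewrite opp_lfunE linearN /= -betaV_sym ?lI //.
by rewrite ij lagrangian_path_transverse // -ij ltnW.
Qed.

(* sP is kept as an argument because symmetry needs it. *)
Definition sylvester_sform := let _ := sP in sylvester_form.
HB.instance Definition _ := Bilinear.copy sylvester_sform sylvester_form.
Fact sylvester_sform_sym x y :
  sylvester_sform x y = (-1) ^+ false * idfun (sylvester_sform y x).
Proof. by rewrite expr0 mul1r; apply: sylvester_formC. Qed.
HB.instance Definition _ := isHermitianSesquilinear.Build k _ false idfun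
  sylvester_sform sylvester_sform_sym.

Definition sylvester := SymSpace sylvester_sform.

End Sylvester.

End Symplectic.

Arguments lagrangian_path {k g} s.
Arguments sylvester {k g s} sP.

(* Main.v *)
Require Import Defs.
From HB Require Import structures.
From mathcomp Require Import all_boot all_order all_algebra zify ring.

Set Implicit Arguments.
Unset Strict Implicit.
Unset Printing Implicit Defensive.

Import GRing.Theory.
Local Open Scope ring_scope.

(** A vector x in the direct sum of the duals of the inner Lagrangians is a
    family of functionals x_a on L_a, for 0 < a < N - 1, and is completed by
    x_0 = 0 and x_(N-1) = 0.  Two consecutive Lagrangians being transverse,
    there is exactly one vector r_t of the symplectic space which represents
    x_(t-1) on L_(t-1) and x_t on L_t.  Since r_t and r_(t+1) both represent
    x_t, they differ by an element of L_t = L_t^perp.  So x amounts to a chain: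
    a sequence r_0 = 0, r_1, ..., r_N = 0 with r_(t+1) - r_t in L_t ([chain_of],
    [restrict], [chain_ofK], [restrictK]).  The image of y under the Sylvester
    matrix has components u_(t+1) - u_t, where u is the chain of y
    ([chain_of_step]), hence the form is
      S(x, y) = \sum_t omega (r_t, u_(t+1) - u_t)    ([sylvester_formE]).

    Let now L_i and L_j be transverse, i < j.  A unique vector c represents x_i
    on L_i and x_j on L_j.  Replacing the stretch r_(i+1), ..., r_j of the chain
    by the single vector c gives a chain of the shortened path, and subtracting
    c from this stretch gives a chain of L_i, ..., L_j.  Both steps are
    reversible, because c can be read off the shortened chain.  The form is
    additive under this operation ([chain_form_split]): the sum over the stretch
    telescopes against c, and at its two ends r_i - c and r_j - c pair to zero
    with the increments, by isotropy of L_i and L_j.  The splitting of chains is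
    therefore the required isometry. *)

(** * Chains of vectors along a sequence of subspaces *)

Section Chains.

Variables (k : fieldType) (g : nat).
Local Notation H := (hyperbolic k g).
Implicit Types (L : nat -> {vspace H}) (r u : nat -> H) (N i j t : nat).

(** The vector [r t] belongs to the gap between [L t.-1] and [L t]; the two
    boundary values stand for the gaps outside the sequence.  Indexing by all
    naturals, with only the values up to [N] meaningful, lets chains be shifted
    and cut without transporting dependent types. *)
Definition chain N L r : Prop :=
  [/\ r 0%N = 0, r N = 0 & forall t, (t < N)%N -> r t.+1 - r t \in L t].

Definition chain_form N r u : k := \sum_(t < N) omega (r t) (u t.+1 - u t).

Lemma eq_chain_form N r r' u u' :
    (forall t, (t <= N)%N -> r t = r' t) ->
    (forall t, (t <= N)%N -> u t = u' t) ->
  chain_form N r u = chain_form N r' u'.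
Proof.
move=> er eu; apply: eq_bigr => t _.
by rewrite er ?eu // ltnW.
Qed.

Lemma eq_chain N L L' r : (forall t, (t < N)%N -> L t = L' t) ->
  chain N L r -> chain N L' r.
Proof. by move=> eL [r0 rN rL]; split=> // t tN; rewrite -eL // rL. Qed.

Lemma omega_orth_transverse (A B : {vspace H}) (w : H) : transverse A B ->
  {in A, forall v, omega w v = 0} -> {in B, forall v, omega w v = 0} -> w = 0.
Proof.
move=> /eqP AB wA wB; apply: omega_nondeg => v.
have /memv_addP[a aA [b bB ->]] : v \in (A + B)%VS by rewrite AB memvf.
by rewrite linearDr /= wA ?wB ?addr0.
Qed.

(** The increment at the last index lies in [L N.+1], like [r N.+1] itself,
    which differs from [r N.+2 = 0] by an element of [L N.+1]. *)
Lemma chain_form_middle N L r u : lagrangian (L N.+1) ->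
    chain N.+2 L r -> chain N.+2 L u ->
  chain_form N.+2 r u = \sum_(a < N) omega (r a.+1) (u a.+2 - u a.+1).
Proof.
move=> lN [r0 rN rL] [u0 uN uL].
rewrite /chain_form big_ord_recl big_ord_recr /= r0 linear0l add0r.
rewrite (lagrangian_omega lN) ?addr0 //; last exact: uL.
by have := rL _ (ltnSn _); rewrite rN sub0r memvN.
Qed.

Lemma sum_ord_pivot m n (F : nat -> k) :
  \sum_(t < m + n.+1) F t
    = \sum_(t < m) F t + (F m + \sum_(t < n) F (m.+1 + t)%N).
Proof.
rewrite big_split_ord big_ord_recl /= addn0; congr (_ + (_ + _)).
by apply: eq_bigr => t _; rewrite /bump /= add1n addSnnS.
Qed.

(** * Splitting a chain at two transverse Lagrangians *)

Section Split.

Variables (L : nat -> {vspace H}) (i d e : nat).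
Local Notation j := (i + d.+1)%N.
Local Notation N := (j + e.+1)%N.

(** The vector congruent to [r i] modulo [L i] and to [r j.+1] modulo [L j]; for
    a chain, these are also the classes of [r i.+1] and [r j].  The values [r i]
    and [r j.+1] are used because they survive in the shortened chain.  Here
    [d] is the number of Lagrangians strictly between [L i] and [L j]. *)
Definition bridge r : H :=
  daddv_pi (L j) (L i) (r i) + daddv_pi (L i) (L j) (r j.+1).

Definition inner c r t : H := if (0 < t <= d.+1)%N then r (i + t)%N - c else 0.

Definition outer c r t : H :=
  if (t <= i)%N then r t else if t == i.+1 then c else r (t + d)%N.

Definition glue r r' t : H :=
  if (t <= i)%N then r' t
  else if (t <= j)%N then r (t - i)%N + r' i.+1 else r' (t - d)%N.

Definition shortcut t := if (t <= i)%N then L t else L (t + d)%N.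

(** These congruences characterize [bridge r] when [L i] and [L j] are
    transverse Lagrangians ([bridgeP], [bridge_uniq]). *)
Definition bridges c r : Prop := c - r i \in L i /\ c - r j.+1 \in L j.

Lemma outer_before c r t : (t <= i)%N -> outer c r t = r t.
Proof. by rewrite /outer => ->. Qed.

Lemma outer_bridge c r : outer c r i.+1 = c.
Proof. by rewrite /outer ltnn eqxx. Qed.

Lemma outer_after c r t : outer c r (i.+2 + t)%N = r (j.+1 + t)%N.
Proof.
rewrite /outer; have -> : (i.+2 + t <= i)%N = false by lia.
have -> : (i.+2 + t == i.+1)%N = false by lia.
by congr r; lia.
Qed.

Lemma bridge_linear a r u :
  bridge (fun t => a *: r t + u t) = a *: bridge r + bridge u.
Proof. by rewrite /bridge !linearP scalerDr addrACA. Qed.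

Section Pair.

Variables (r : nat -> H) (c : H).
Hypotheses (rC : chain N L r) (cB : bridges c r).

Lemma inner_chain : chain d.+2 (fun t => L (i + t)%N) (inner c r).
Proof.
have [r0 rN rL] := rC; have [cI cJ] := cB.
split=> // [|t]; first by rewrite /inner ltnn.
rewrite ltnS leq_eqVlt => /predU1P[->|td]; rewrite /inner.
  rewrite ltnn ltnSn /= sub0r opprB.
  rewrite -[c - _](subrKA (r j.+1)) memvD //; apply: rL; lia.
rewrite td /= addnS; case: t td => [|t] td /=.
  rewrite addn0 subr0 -[X in X \in _](subrKA (r i)) memvD //.
    by apply: rL; lia.
  by rewrite -opprB memvN.
by rewrite ltnW // opprB addrA subrK; apply: rL; lia.
Qed.

Lemma outer_chain : chain (i + e.+2)%N shortcut (outer c r).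
Proof.
have [r0 rN rL] := rC; have [cI cJ] := cB.
split=> // [|t tN]; rewrite /outer /shortcut.
  case: ifP => [|_]; first lia.
  case: ifP => [|_]; first lia.
  by rewrite (_ : (_ + d)%N = N) //; lia.
have [ti|ti|->] := ltngtP t i; last by rewrite eqxx.
  by apply: rL; lia.
case: ifP => [|_]; first lia.
have [->|ti'] := eqVneq t i.+1.
  have [-> ->] : (i.+2 + d)%N = j.+1 /\ (i.+1 + d)%N = j by lia.
  by rewrite -opprB memvN.
by rewrite addSn rL //; lia.
Qed.

Lemma glue_inner_outer t : (t <= N)%N -> glue (inner c r) (outer c r) t = r t.
Proof.
move=> tN; rewrite /glue /inner /outer ltnn eqxx.
have [//|ti] := leqP t i; have [tj|tj] := leqP t j.
  by rewrite ifT ?subrK ?subnKC //; lia.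
by rewrite !ifF ?subnK //; lia.
Qed.

End Pair.

Section Glue.

Variables r r' : nat -> H.
Hypotheses (rC : chain d.+2 (fun t => L (i + t)%N) r).
Hypothesis rC' : chain (i + e.+2)%N shortcut r'.

(** The vector in the gap between [L i] and [L j] of the shortened chain is the
    bridge of the glued chain, which is what makes the splitting reversible. *)
Lemma bridges_glue : bridges (r' i.+1) (glue r r').
Proof.
have [r0 rN rL] := rC; have [r0' rN' rL'] := rC'.
have /rL' : (i < i + e.+2)%N by lia.
have /rL' : (i.+1 < i + e.+2)%N by lia.
rewrite /bridges /glue /shortcut leqnn !ltnn addSnnS => rJ rI.
have [-> ->] : (j < i)%N = false /\ (j.+1 - d)%N = i.+2 by lia.
by split=> //; rewrite -opprB memvN.
Qed.

Lemma glue_chain : chain N L (glue r r').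
Proof.
have [r0 rN rL] := rC; have [r0' rN' rL'] := rC'.
split=> // [|t tN]; rewrite /glue.
  case: ifP => [|_]; first lia.
  case: ifP => [|_]; first lia.
  by rewrite (_ : (_ - d)%N = (i + e.+2)%N) //; lia.
have [ti|ti|->] := ltngtP t i.
- have rI : r' t.+1 - r' t \in shortcut t by apply: rL'; lia.
  by rewrite /shortcut (ltnW ti) in rI.
- have [tj|tj|->] := ltngtP t j.
  + have /rL : (t - i < d.+2)%N by lia.
    by rewrite -subSn ?subnKC 1?ltnW // opprD addrACA subrr addr0.
  + have /rL' : (t - d < i + e.+2)%N by lia.
    have [-> ->] : (t - d).+1 = (t.+1 - d)%N /\ shortcut (t - d) = L t.
      rewrite /shortcut; split; first lia.
      have [-> dt] : (t - d <= i)%N = false /\ (d <= t)%N by lia.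
      by rewrite subnK.
    by [].
  have [-> ->] : (j.+1 - d)%N = i.+2 /\ (j - i)%N = d.+1 by lia.
  have /rL' : (i.+1 < i + e.+2)%N by lia.
  have /rL : (d.+1 < d.+2)%N by lia.
  rewrite rN sub0r /shortcut ltnn addSnnS => rI rI'.
  by rewrite opprD addrCA memvD.
have /rL' : (i < i + e.+2)%N by lia.
have /rL : (0 < d.+2)%N by lia.
have -> : (i < j)%N by lia.
rewrite addn0 r0 subr0 /shortcut leqnn subSnn -addrA => rI rI'.
by rewrite memvD.
Qed.

Lemma inner_glue t : (t <= d.+2)%N -> inner (r' i.+1) (glue r r') t = r t.
Proof.
have [r0 rN rL] := rC; move=> td; rewrite /inner /glue.
case: t td => [|t] td; first by rewrite r0.
have [tE|tE] := leqP t.+1 d.+1.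
  by rewrite ifF ?ifT ?addKn ?addrK //; lia.
by rewrite (_ : t.+1 = d.+2) ?rN //; lia.
Qed.

Lemma outer_glue t : (t <= i + e.+2)%N -> outer (r' i.+1) (glue r r') t = r' t.
Proof.
move=> tN; rewrite /outer /glue.
have [//|ti] := leqP t i; have [-> //|ti'] := eqVneq t i.+1.
by rewrite !ifF ?addnK //; lia.
Qed.

End Glue.

(** Away from the indices [i] and [j], the terms of the left-hand side appear
    on the right, except for the terms [omega c (u t.+1 - u t)] removed by
    [inner], which telescope.  At [i] and [j], isotropy allows [r i] and [r j]
    to be replaced by [c] in the products that remain, and everything cancels.
    *)
Lemma chain_form_split r u c b : lagrangian (L i) -> lagrangian (L j) ->
    chain N L r -> chain N L u ->
    bridges c r -> bridges b u ->
  chain_form N r u = chain_form d.+2 (inner c r) (inner b u)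
               + chain_form (i + e.+2)%N (outer c r) (outer b u).
Proof.
move=> lI lJ rC uC cB bB.
have [r0 rN rL] := rC; have [u0 uN uL] := uC.
have [cI cJ] := cB; have [bI bJ] := bB.
have -> : chain_form N r u = \sum_(t < i) omega (r t) (u t.+1 - u t)
    + (omega (r i) (u i.+1 - u i)
       + \sum_(t < d) omega (r (i.+1 + t)%N) (u (i.+1 + t).+1 - u (i.+1 + t)%N))
    + (omega (r j) (u j.+1 - u j)
       + \sum_(t < e) omega (r (j.+1 + t)%N)
                            (u (j.+1 + t).+1 - u (j.+1 + t)%N)).
  rewrite /chain_form (sum_ord_pivot j e (fun t => omega (r t) (u t.+1 - u t))).
  by rewrite (sum_ord_pivot i d (fun t => omega (r t) (u t.+1 - u t))).
have -> : chain_form (i + e.+2)%N (outer c r) (outer b u)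
    = \sum_(t < i) omega (r t) (u t.+1 - u t)
    + (omega (r i) (b - u i) + (omega c (u j.+1 - b)
       + \sum_(t < e) omega (r (j.+1 + t)%N)
                            (u (j.+1 + t).+1 - u (j.+1 + t)%N))).
  pose F t := omega (outer c r t) (outer b u t.+1 - outer b u t).
  rewrite /chain_form (sum_ord_pivot i e.+1 F) big_ord_recl {}/F /= addn0.
  have outer_after0 v f : outer v f i.+2 = f j.+1.
    by have := outer_after v f 0; rewrite !addn0.
  rewrite !outer_bridge outer_after0 !outer_before //.
  congr (_ + (_ + (_ + _))); apply: eq_bigr => t _.
    by rewrite !outer_before // ltnW.
  have -> : (i.+1 + bump 0 t)%N = (i.+2 + t)%N by rewrite /bump /=; lia.
  by rewrite -[(i.+2 + t).+1]addnS -[(j.+1 + t).+1]addnS !outer_after.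
have -> : chain_form d.+2 (inner c r) (inner b u)
    = \sum_(t < d) omega (r (i.+1 + t)%N) (u (i.+1 + t).+1 - u (i.+1 + t)%N)
      - omega c (u j - u i.+1).
  rewrite (chain_form_middle _ (inner_chain rC cB) (inner_chain uC bB)) //.
  have -> : u j - u i.+1 = \sum_(t < d) (u (i.+1 + t).+1 - u (i.+1 + t)%N).
    rewrite -(big_mkord xpredT (fun t => u (i.+1 + t).+1 - u (i.+1 + t)%N)).
    rewrite (telescope_sumr_eq (fun t => u (i.+1 + t)%N)) //.
      by rewrite addn0 addSnnS.
    by move=> t _; rewrite -[(i.+1 + t).+1]addnS.
  rewrite linear_sumr -sumrB; apply: eq_bigr => t _.
  have td := ltn_ord t.
  rewrite /inner; have [-> ->] : (0 < t.+1 <= d.+1)%N /\ (0 < t.+2 <= d.+1)%N.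
    by lia.
  rewrite opprB addrA subrK linearBl /=.
  by rewrite -[(i.+1 + t).+1]addnS !addSnnS.
(* Both c - r i and u i.+1 - b lie in the isotropic subspace L i. *)
have rI : omega (r i) (u i.+1 - b) = omega c (u i.+1 - b).
  apply/eqP; rewrite eq_sym -subr_eq0 -linearBl /=; apply/eqP.
  apply: (lagrangian_omega lI) => //.
  by rewrite -(subrKA (u i)) memvD ?uL -?[u i - b]opprB ?memvN //; lia.
(* Similarly c - r j and u j.+1 - u j lie in L j. *)
have rJ : omega (r j) (u j.+1 - u j) = omega c (u j.+1 - u j).
  apply/eqP; rewrite eq_sym -subr_eq0 -linearBl /=; apply/eqP.
  apply: (lagrangian_omega lJ); last by apply: uL; lia.
  by rewrite -(subrKA (r j.+1)) memvD ?rL //; lia.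
rewrite rJ; move: rI; rewrite !linearBr /= => rI.
set A := \sum_(t < i) _; set B := \sum_(t < d) _; set C := \sum_(t < e) _.
have -> : omega (r i) (u i.+1) = omega (r i) b + (omega c (u i.+1) - omega c b).
  by rewrite -rI addrC subrK.
ring.
Qed.

Hypotheses (lI : lagrangian (L i)) (lJ : lagrangian (L j)).
Hypothesis tIJ : transverse (L i) (L j).

Lemma bridgeP r : bridges (bridge r) r.
Proof.
have IJ0 := transverse_capv lI lJ tIJ.
have piD w : daddv_pi (L i) (L j) w + daddv_pi (L j) (L i) w = w.
  by rewrite daddv_pi_add // (eqP tIJ) memvf.
split; rewrite /bridge.
  rewrite -{2}(piD (r i)) opprD [X in X + _]addrC addrACA subrr addr0.
  by rewrite memvB ?memv_pi.
rewrite -{2}(piD (r j.+1)) opprD addrA addrK.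
by rewrite memvB ?memv_pi.
Qed.

Lemma bridge_uniq c r : bridges c r -> bridge r = c.
Proof.
have [bI bJ] := bridgeP r; move=> [cI cJ].
apply/eqP; rewrite -subr_eq0 -memv0 -(transverse_capv lI lJ tIJ) memv_cap.
apply/andP; split; [rewrite -(subrKA (r i)) | rewrite -(subrKA (r j.+1))].
  by rewrite memvD // -opprB memvN.
by rewrite memvD // -opprB memvN.
Qed.

End Split.

(** * The Sylvester form as a form on chains *)

Section Path.

Variable s : seq {vspace H}.
Local Notation L := (nth 0%VS s).
Local Notation N := (size s).

Definition restrict r : sylvester_dom s :=
  [ffun a : 'I_(N - 2) => omega_on (L a.+1) (r a.+1)].

Lemma restrictE r (a : 'I_(N - 2)) v : v \in L a.+1 ->
  restrict r a (vsproj (L a.+1) v) = omega (r a.+1) v.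
Proof. by move=> vL; rewrite ffunE omega_onE vsprojK. Qed.

Lemma eq_restrict r r' : (forall t, (t <= N)%N -> r t = r' t) ->
  restrict r = restrict r'.
Proof.
by move=> e; apply/ffunP => a; rewrite !ffunE e //; have := ltn_ord a; lia.
Qed.

Lemma restrict_linear a r r' :
  restrict (fun t => a *: r t + r' t) = a *: restrict r + restrict r'.
Proof. by apply/ffunP => b; rewrite !ffunE linearP. Qed.

Hypothesis sP : lagrangian_path s.

Let lagr t : (t < N)%N -> lagrangian (L t).
Proof. exact: lagrangian_path_nth. Qed.

Let trans t : (t.+1 < N)%N -> transverse (L t) (L t.+1).
Proof. exact: lagrangian_path_transverse. Qed.

(** At the inner indices this is the hypothesis on [restrict r]; at the two ends
    it comes from the boundary values of the chain. *)
Lemma chain_restrict_orth r : chain N L r -> restrict r = 0 ->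
  forall t, (t < N)%N -> {in L t, forall v, omega (r t) v = 0}.
Proof.
move=> [r0 rN rL] rs t tN v vL.
case: t tN vL => [|t] tN vL; first by rewrite r0 linear0l.
have [tl|tl] := ltnP t (N - 2).
  have := congr1 (fun x : sylvester_dom s => x (Ordinal tl)
    (vsproj (L t.+1) v)) rs.
  by rewrite restrictE // ffunE zero_lfunE.
have tE : t.+2 = N by lia.
have := rL _ tN; rewrite tE rN sub0r memvN => rtL.
exact: (lagrangian_omega (lagr tN)).
Qed.

(** [r t.+1] is orthogonal to [L t], being congruent to [r t] modulo [L t], and
    to [L t.+1]; these two span the whole space. *)
Lemma chain_restrict0 r : chain N L r -> restrict r = 0 ->
  forall t, (t <= N)%N -> r t = 0.
Proof.
move=> rC rs t; have [r0 rN rL] := rC.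
have rO := chain_restrict_orth rC rs.
case: t => [|t] tN; first by rewrite r0.
move: (tN); rewrite leq_eqVlt => /predU1P[-> //|tN'].
apply: (omega_orth_transverse (trans tN')) => [v vL|]; last exact: rO.
rewrite -[r t.+1](subrK (r t)) linearDl /= rO // addr0.
exact: (lagrangian_omega (lagr tN)) (rL _ tN) vL.
Qed.

Lemma chain_restrict_inj r r' : chain N L r -> chain N L r' ->
  restrict r = restrict r' -> forall t, (t <= N)%N -> r t = r' t.
Proof.
move=> [r0 rN rL] [r0' rN' rL'] e t tN.
apply/eqP; rewrite -subr_eq0; apply/eqP.
have -> : r t - r' t = -1 *: r' t + r t by rewrite scaleN1r addrC.
apply: (chain_restrict0 (r := fun t => -1 *: r' t + r t)) tN => /=.
  split=> [||u uN]; rewrite ?r0 ?r0' ?rN ?rN' ?scaler0 ?addr0 //.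
  rewrite opprD addrACA -scalerN -scalerDr memvD ?memvZ //; first exact: rL'.
  exact: rL.
by rewrite restrict_linear e scaleN1r addNr.
Qed.

(** The representatives of the functional [x a] on [L a.+1] by elements of the
    two neighbouring Lagrangians. *)
Definition left_rep (x : sylvester_dom s) (a : 'I_(N - 2)) : H :=
  vsval ((beta (L a) (L a.+1))^-1%VF (x a)).

Definition right_rep (x : sylvester_dom s) (a : 'I_(N - 2)) : H :=
  vsval ((beta (L a.+2) (L a.+1))^-1%VF (x a)).

(** In the gap [t], the sum of the element of [L t] representing x_(t-1) on
    [L t.-1] and of the element of [L t.-1] representing x_t on [L t]: each
    summand lies in the Lagrangian on which the other one is tested.  Summing
    over ordinals, with at most one index in each sum, yields zero where x_(t-1)
    or x_t does not exist. *)
Definition chain_of (x : sylvester_dom s) t : H :=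
  \sum_(a : 'I_(N - 2) | a.+1 == t) left_rep x a
  + \sum_(a : 'I_(N - 2) | a.+2 == t) right_rep x a.

Lemma chain_of_linear c x y t :
  chain_of (c *: x + y) t = c *: chain_of x t + chain_of y t.
Proof.
rewrite /chain_of scalerDr !scaler_sumr addrACA -!big_split /=.
by congr (_ + _); apply: eq_bigr => a _;
  rewrite /left_rep /right_rep !ffunE !linearP.
Qed.

Lemma ltn_middle (a : 'I_(N - 2)) : (a.+2 < N)%N.
Proof. by have := ltn_ord a; lia. Qed.

Lemma chain_of1E x (a : 'I_(N - 2)) :
  chain_of x a.+1
    = left_rep x a + \sum_(b : 'I_(N - 2) | b.+1 == a) right_rep x b.
Proof. by rewrite /chain_of (big_pred1 a). Qed.

Lemma chain_of2E x (a : 'I_(N - 2)) :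
  chain_of x a.+2
    = \sum_(b : 'I_(N - 2) | b == a.+1 :> nat) left_rep x b + right_rep x a.
Proof. by rewrite /chain_of [X in _ + X](big_pred1 a). Qed.

(** The two representatives of [x a] contribute the diagonal block, and the
    remaining summands of the two gaps are the two off-diagonal blocks of row
    [a]. *)
Lemma chain_of_step x (a : 'I_(N - 2)) :
  chain_of x a.+2 - chain_of x a.+1 = vsval (sylvester_map x a).
Proof.
have aN := ltn_middle a.
have tL : transverse (L a) (L a.+1) by apply: trans; rewrite ltnW.
have tR : transverse (L a.+2) (L a.+1) by rewrite transverseC trans.
have -> : vsval (sylvester_map x a) = right_rep x a - left_rep x a
    + \sum_(b | b != a) vsval (sylvester_offdiag a b (x b)).
  rewrite ffunE linearD linear_sum /=.
  by rewrite vsval_dmap ?lagr // 1?ltnW // 1?ltnW.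
rewrite chain_of1E chain_of2E.
have -> : \sum_(b | b != a) vsval (sylvester_offdiag a b (x b)) =
    \sum_(b : 'I_(N - 2) | b == a.+1 :> nat) left_rep x b
    - \sum_(b : 'I_(N - 2) | b.+1 == a) right_rep x b.
  rewrite -sumrN big_mkcond [X in _ = X + _]big_mkcond.
  rewrite [X in _ = _ + X]big_mkcond -big_split; apply: eq_bigr => b _ /=.
  rewrite /sylvester_offdiag /left_rep /right_rep.
  have [ba|bNa] := eqVneq (b : nat) a.+1.
    have -> : (b == a) = false by apply/eqP => e; move: ba; rewrite e; lia.
    have -> : (b.+1 == a :> nat) = false by apply/eqP; lia.
    by rewrite addr0 -ba.
  rewrite add0r [_ == b.+1]eq_sym.
  have [ba|bNa'] := eqVneq b.+1 (a : nat).
    have -> : (b == a) = false by apply/eqP => e; move: ba; rewrite e; lia.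
    by rewrite opp_lfunE linearN /= -ba.
  by rewrite zero_lfunE linear0 if_same.
by rewrite opprD [_ + right_rep x a]addrC addrACA.
Qed.

Lemma chain_ofP x : chain N L (chain_of x).
Proof.
have N2 : (1 < N)%N by case/and3P: sP.
split=> [||t tN].
- by rewrite /chain_of !big_pred0 ?addr0 // => a.
- rewrite /chain_of !big_pred0 ?addr0 // => a; apply/eqP;
    by have := ltn_middle a; lia.
case: t tN => [|t] tN.
  rewrite /chain_of memvB // memvD ?memv_suml // => a /eqP // [aE].
  by rewrite (_ : L 0 = L a) ?subvsP // aE.
have [tl|tl] := ltnP t (N - 2).
  by rewrite (chain_of_step x (Ordinal tl)) subvsP.
have tE : t.+2 = N by lia.
rewrite /chain_of memvB // memvD ?memv_suml // => a /eqP aE.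
- by have := ltn_middle a; lia.
- by have := ltn_middle a; lia.
- by have := ltn_middle a; lia.
- by rewrite /right_rep -aE subvsP.
Qed.

Lemma chain_ofK x : restrict (chain_of x) = x.
Proof.
apply/ffunP => a; apply/lfunP => v; have aN := ltn_middle a.
have aN' : (a.+1 < N)%N by rewrite ltnW.
have aN'' : (a < N)%N by rewrite ltnW.
rewrite ffunE omega_onE chain_of1E linearDl /=.
rewrite /left_rep omega_betaV ?lagr ?trans //.
rewrite (lagrangian_omega (lagr aN')) ?subvsP ?addr0 // memv_suml // => b.
by move=> /eqP <-; rewrite subvsP.
Qed.

(** Both chains have the same restriction. *)
Lemma restrictK r : chain N L r ->
  forall t, (t <= N)%N -> chain_of (restrict r) t = r t.
Proof.
move=> rC; apply: chain_restrict_inj => //; first exact: chain_ofP.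
exact: chain_ofK.
Qed.

Lemma sylvester_formE x y :
  sylvester_form x y = chain_form N (chain_of x) (chain_of y).
Proof.
have N2 : (1 < N)%N by case/and3P: sP.
have NE : (N - 2).+2 = N by lia.
have -> : chain_form N (chain_of x) (chain_of y)
    = chain_form (N - 2).+2 (chain_of x) (chain_of y).
  by rewrite NE.
rewrite (chain_form_middle (L := L)) ?NE; last 3 first.
- by apply: lagr; lia.
- exact: chain_ofP.
- exact: chain_ofP.
apply: eq_bigr => a _; rewrite -[in LHS](chain_ofK x) ffunE omega_onE.
by rewrite chain_of_step.
Qed.

End Path.
End Chains.

(** * The isometry *)

Section Splitting.

Variables (k : fieldType) (g : nat) (s : seq {vspace hyperbolic k g}).
Variables i d e : nat.
Local Notation L := (nth 0%VS s).
Local Notation j := (i + d.+1)%N.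
Local Notation s1 := (drop i (take j.+1 s)).
Local Notation s2 := (take i.+1 s ++ drop j s).

Hypothesis sz : size s = (j + e.+1)%N.

Lemma size_segment : size s1 = d.+2.
Proof. by rewrite size_drop size_takel ?sz; lia. Qed.

Lemma nth_segment t : (t < d.+2)%N -> nth 0%VS s1 t = L (i + t)%N.
Proof. by move=> td; rewrite nth_drop nth_take //; lia. Qed.

Lemma size_shortcut : size s2 = (i + e.+2)%N.
Proof. by rewrite size_cat size_drop size_takel ?sz; lia. Qed.

Lemma nth_shortcut t : nth 0%VS s2 t = shortcut L i d t.
Proof.
rewrite nth_cat size_takel ?sz; last lia.
rewrite /shortcut ltnS; case: leqP => ti; first by rewrite nth_take.
by rewrite nth_drop; congr nth; lia.
Qed.

Hypothesis sP : lagrangian_path s.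

Lemma lagrangian_path_segment : lagrangian_path s1.
Proof.
have /and3P[_ lL tL] := sP; apply/and3P; split.
- by rewrite size_segment.
- by apply/allP => X /mem_drop /mem_take; apply: (allP lL).
- exact/drop_sorted/take_sorted.
Qed.

Hypothesis tIJ : transverse (L i) (L j).

Lemma lagrangian_path_shortcut : lagrangian_path s2.
Proof.
have /and3P[_ lL tL] := sP; apply/and3P; split.
- by rewrite size_shortcut; lia.
- by apply/allP => X; rewrite mem_cat => /orP[/mem_take|/mem_drop];
    apply: (allP lL).
apply/(sortedP 0%VS) => t; rewrite size_shortcut !nth_shortcut => tN.
rewrite /shortcut; have [ti|ti|->] := ltngtP t i.
- by apply: (lagrangian_path_transverse sP); lia.
- by apply: (lagrangian_path_transverse sP); rewrite sz; lia.
- by rewrite addSnnS.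
Qed.

Local Notation cut x := (bridge L i d (chain_of x)).

Definition split_sylvester (x : sylvester_dom s) :
    sylvester_dom s1 * sylvester_dom s2 :=
  (restrict s1 (inner i d (cut x) (chain_of x)),
   restrict s2 (outer i d (cut x) (chain_of x))).

Lemma split_sylvester_linear : linear split_sylvester.
Proof.
move=> a x y.
have cutE : cut (a *: x + y) = a *: cut x + cut y.
  by rewrite -bridge_linear /bridge !chain_of_linear.
congr pair; rewrite -restrict_linear; apply: eq_restrict => t _.
  rewrite /inner chain_of_linear cutE.
  case: ifP => _; last by rewrite scaler0 addr0.
  by rewrite scalerBr opprD addrACA.
by rewrite /outer !chain_of_linear cutE; do 2!case: ifP => // _.
Qed.

HB.instance Definition _ := GRing.isSemilinear.Build k _ _ _ split_sylvester
  (GRing.semilinear_linear split_sylvester_linear).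

Definition glue_sylvester (yz : sylvester_dom s1 * sylvester_dom s2) :
    sylvester_dom s :=
  restrict s (glue i d (chain_of yz.1) (chain_of yz.2)).

Let lI : lagrangian (L i).
Proof. by apply: lagrangian_path_nth => //; rewrite sz; lia. Qed.

Let lJ : lagrangian (L j).
Proof. by apply: lagrangian_path_nth => //; rewrite sz; lia. Qed.

Let bridgesP r : bridges L i d (bridge L i d r) r.
Proof. exact: bridgeP. Qed.

Lemma chain_ofP_sz (x : sylvester_dom s) : chain (j + e.+1) L (chain_of x).
Proof. by rewrite -sz; apply: chain_ofP. Qed.

Lemma chain_segment r :
  chain d.+2 (fun t => L (i + t)%N) r <-> chain (size s1) (nth 0%VS s1) r.
Proof.
rewrite size_segment.
by split; apply: eq_chain => t td; rewrite nth_segment.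
Qed.

Lemma chain_shortcut r :
  chain (i + e.+2) (shortcut L i d) r <-> chain (size s2) (nth 0%VS s2) r.
Proof.
rewrite size_shortcut.
by split; apply: eq_chain => t _; rewrite nth_shortcut.
Qed.

Lemma chain_of_split1 x t : (t <= d.+2)%N ->
  chain_of (split_sylvester x).1 t = inner i d (cut x) (chain_of x) t.
Proof.
rewrite -size_segment; apply: restrictK; first exact: lagrangian_path_segment.
by apply/chain_segment; apply: (inner_chain (chain_ofP_sz x) (bridgesP _)).
Qed.

Lemma chain_of_split2 x t : (t <= i + e.+2)%N ->
  chain_of (split_sylvester x).2 t = outer i d (cut x) (chain_of x) t.
Proof.
rewrite -size_shortcut.
apply: restrictK; first exact: lagrangian_path_shortcut.
by apply/chain_shortcut; apply: (outer_chain (chain_ofP_sz x) (bridgesP _)).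
Qed.

Lemma split_sylvesterK : cancel split_sylvester glue_sylvester.
Proof.
move=> x; rewrite -[RHS](chain_ofK sP); apply: eq_restrict => t.
rewrite sz => tN.
rewrite -[RHS](glue_inner_outer (chain_of x) (cut x) tN) /glue.
case: leqP => ti; first by rewrite chain_of_split2 //; lia.
case: leqP => tj; last by rewrite chain_of_split2 //; lia.
by rewrite chain_of_split1 ?chain_of_split2 //; lia.
Qed.

(** The chain of the glued vector is the glued chain, whose bridge is the
    entry [i.+1] of the shortened chain; so cutting it again recovers the two
    pieces. *)
Lemma glue_sylvesterK : cancel glue_sylvester split_sylvester.
Proof.
case=> y z.
have yC : chain d.+2 (fun t => L (i + t)%N) (chain_of y).
  exact/chain_segment/chain_ofP/lagrangian_path_segment.
have zC : chain (i + e.+2) (shortcut L i d) (chain_of z).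
  exact/chain_shortcut/chain_ofP/lagrangian_path_shortcut.
have gC : chain (size s) L (glue i d (chain_of y) (chain_of z)).
  by rewrite sz; apply: glue_chain.
have gE t : (t <= j + e.+1)%N ->
    chain_of (glue_sylvester (y, z)) t = glue i d (chain_of y) (chain_of z) t.
  by rewrite -sz; apply: restrictK.
have cutE : cut (glue_sylvester (y, z)) = chain_of z i.+1.
  rewrite /bridge !gE; try lia.
  exact: (bridge_uniq lI lJ tIJ (bridges_glue yC zC)).
rewrite /split_sylvester cutE; congr pair.
  rewrite -[RHS](chain_ofK lagrangian_path_segment).
  apply: eq_restrict => t; rewrite size_segment => td.
  rewrite -[RHS](inner_glue (chain_of z) yC td) /inner.
  by case: ifP => // tE; rewrite gE //; lia.
rewrite -[RHS](chain_ofK lagrangian_path_shortcut).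
apply: eq_restrict => t; rewrite size_shortcut => tN.
rewrite -[RHS](outer_glue d (chain_of y) (chain_of z) tN) /outer.
case: leqP => ti; first by rewrite gE //; lia.
by case: ifP => // tE; rewrite gE //; lia.
Qed.

Lemma split_sylvester_form x y :
  sylvester_form x y
    = sylvester_form (split_sylvester x).1 (split_sylvester y).1
    + sylvester_form (split_sylvester x).2 (split_sylvester y).2.
Proof.
have h1 := lagrangian_path_segment; have h2 := lagrangian_path_shortcut.
rewrite (sylvester_formE sP) (sylvester_formE h1).
rewrite (sylvester_formE h2) size_segment size_shortcut sz.
rewrite (chain_form_split lI lJ (chain_ofP_sz x) (chain_ofP_sz y)
  (bridgesP _) (bridgesP _)).
by congr (_ + _); apply: eq_chain_form => t tN;
  rewrite ?chain_of_split1 ?chain_of_split2.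
Qed.

Lemma sylvester_split (h1 : lagrangian_path s1) (h2 : lagrangian_path s2) :
  isometric (sylvester sP) (orth_sum (sylvester h1) (sylvester h2)).
Proof.
exists split_sylvester; split.
  exists glue_sylvester; [exact: split_sylvesterK | exact: glue_sylvesterK].
by move=> x y; rewrite [RHS]split_sylvester_form.
Qed.

End Splitting.

Theorem lemma1p1 (k : fieldType) (hk : 2%N \notin [pchar k])
    (g : nat) (hg : (1 <= g)%N) (n : nat)
    (La : n.+2.-tuple {vspace hyperbolic k g}) (hLa : lagrangian_path La)
    (i j : 'I_n.+2) (hij : (i < j)%N)
    (htr : transverse (tnth La i) (tnth La j)) :
  exists (hsub : lagrangian_path (drop i (take j.+1 La)))
         (hshort : lagrangian_path (take i.+1 La ++ drop j La)),
    isometric (sylvester hLa)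
      (orth_sum (sylvester hsub) (sylvester hshort)).
Proof.
move: htr; rewrite !(tnth_nth 0%VS).
(* Here d = j - i - 1 Lagrangians are skipped, and n + 1 - j follow L_j. *)
have jE : (j : nat) = (i + (j - i.+1).+1)%N by lia.
have := ltn_ord j; move: (j : nat) jE => {hij}j -> jn htr.
have sz : size La = (i + (j - i.+1).+1 + (n.+2 - (i + (j - i.+1).+1).+1).+1)%N.
  by rewrite size_tuple; lia.
exists (lagrangian_path_segment sz hLa), (lagrangian_path_shortcut sz hLa htr).
exact: (sylvester_split sz hLa htr).
Qed.
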